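(* A commutative ring $A$ corresponds to a local object for the $(Cons^o,Loc^o)$ factorisation system on $CRings^o$ if and only if it is a local ring.
   Context: $CRings$ is the category of commutative unital rings. $Loc$ is the class of localisation maps $A\to A[S^{-1}]$ and $Cons$ the class of conservative maps (maps $u:A\to B$ such that $a$ is invertible iff $u(a)$ is); $(Loc,Cons)$ is a unique factorisation system on $CRings$, viewed as $(Cons^o,Loc^o)$ on the opposite category. A ring $K$ is a point if $K\ne 0$ and every localisation $K\to B$ of finite presentation with $B\neq0$ admits a retraction. A point covering family of $A$ is a family $\{A\to A_i\}$ of localisations of finite presentation such that every ring map $A\to K$ with $K$ a point factors through some $A\to A_i$. A ring $A$ corresponds to a local object if for every point covering family $\{A\to A_i\}$ of $A$, at least one of the maps $A\to A_i$ admits a retraction (in particular the empty family must not be a point covering family). *)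

(* Defs.v *)
(* Rings may be zero (comPzRingType): the zero ring is an object of the
   category of commutative unital rings, and it occurs as a localisation. *)
From mathcomp Require Import all_boot all_algebra.
From mathcomp Require Import boolp classical_sets.

Set Implicit Arguments.
Unset Strict Implicit.
Unset Printing Implicit Defensive.

Import GRing.Theory.
Local Open Scope ring_scope.
Local Open Scope classical_set_scope.

(* The library has GRing.unit only on rings with a nonzero unit element. *)
Definition invertible (A : comPzRingType) (a : A) : Prop :=
  exists b : A, a * b = 1.

(* u exhibits B as A[S^-1] for some S, through the universal property.  S need
   not be multiplicative: the submonoid it generates yields the same ring. *)
Definition localisation (A B : comPzRingType) (u : {rmorphism A -> B}) : Prop :=
  exists S : set A,
    (forall s : A, S s -> invertible (u s)) /\
    forall (C : comPzRingType) (f : {rmorphism A -> C}),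
      (forall s : A, S s -> invertible (f s)) ->
      exists g : {rmorphism B -> C},
        (forall a : A, g (u a) = f a) /\
        forall g' : {rmorphism B -> C}, (forall a : A, g' (u a) = f a) -> g' =1 g.

(* An element of A[X_0, .., X_(n-1)], written as a list of terms c * X^m; the
   library's polynomials require a nonzero coefficient ring. *)
Definition polynomial_terms (A : comPzRingType) (n : nat) : Type :=
  seq (A * {ffun 'I_n -> nat}).

Definition eval_terms (A B : comPzRingType) (u : {rmorphism A -> B}) (n : nat)
    (x : 'I_n -> B) (p : polynomial_terms A n) : B :=
  \sum_(t <- p) u t.1 * \prod_(i < n) x i ^+ t.2 i.

(* B is A[X_0, .., X_(n-1)] / (f_0, .., f_(m-1)), with x_i the class of X_i,
   through the universal property of that quotient. *)
Definition finite_presentation (A B : comPzRingType) (u : {rmorphism A -> B}) : Prop :=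
  exists (n m : nat) (f : 'I_m -> polynomial_terms A n) (x : 'I_n -> B),
    (forall j : 'I_m, eval_terms u x (f j) = 0) /\
    forall (C : comPzRingType) (v : {rmorphism A -> C}) (y : 'I_n -> C),
      (forall j : 'I_m, eval_terms v y (f j) = 0) ->
      exists g : {rmorphism B -> C},
        ((forall a : A, g (u a) = v a) /\ (forall i : 'I_n, g (x i) = y i)) /\
        forall g' : {rmorphism B -> C},
          (forall a : A, g' (u a) = v a) -> (forall i : 'I_n, g' (x i) = y i) ->
          g' =1 g.

Definition has_retraction (A B : comPzRingType) (u : {rmorphism A -> B}) : Prop :=
  exists r : {rmorphism B -> A}, forall a : A, r (u a) = a.

(* The next three notions depend on the factorisation system only through its
   class L of ring maps whose opposites form the right class: for
   (Cons^o, Loc^o), L is localisation. *)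
Definition ring_map_class : Type :=
  forall A B : comPzRingType, {rmorphism A -> B} -> Prop.

Definition point (L : ring_map_class) (K : comPzRingType) : Prop :=
  (1 : K) <> 0 /\
  forall (B : comPzRingType) (u : {rmorphism K -> B}),
    L K B u -> finite_presentation u -> (1 : B) <> 0 -> has_retraction u.

Definition point_covering (L : ring_map_class) (A : comPzRingType) (I : Type)
    (B : I -> comPzRingType) (u : forall i : I, {rmorphism A -> B i}) : Prop :=
  (forall i : I, L A (B i) (u i) /\ finite_presentation (u i)) /\
  forall (K : comPzRingType) (f : {rmorphism A -> K}),
    point L K ->
    exists (i : I) (g : {rmorphism B i -> K}), forall a : A, g (u i a) = f a.

Definition local_object (L : ring_map_class) (A : comPzRingType) : Prop :=
  forall (I : Type) (B : I -> comPzRingType)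
         (u : forall i : I, {rmorphism A -> B i}),
    point_covering L u -> exists i : I, has_retraction (u i).

Definition ideal (A : comPzRingType) (I : set A) : Prop :=
  [/\ I 0, forall x y : A, I x -> I y -> I (x + y)
    & forall a x : A, I x -> I (a * x)].

Definition maximal_ideal (A : comPzRingType) (M : set A) : Prop :=
  [/\ ideal M, ~ M 1
    & forall J : set A, ideal J -> ~ J 1 -> M `<=` J -> J = M].

Definition local_ring (A : comPzRingType) : Prop :=
  exists! M : set A, maximal_ideal M.

(* Main.v *)
From HB Require Import structures.
Require Import Defs.
From mathcomp Require Import all_boot all_algebra.
From mathcomp Require Import boolp classical_sets.
From mathcomp Require Import ring.

Set Implicit Arguments.
Unset Strict Implicit.
Unset Printing Implicit Defensive.

Import GRing.Theory.
Local Open Scope ring_scope.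
Local Open Scope classical_set_scope.
Local Open Scope quotient_scope.

(** The two implications rest on two different supplies of points.

    If A is a local object, then 1 <> 0 in A, since over the zero ring the
    empty family is point covering.  For a in A, the pair A[1/a], A[1/(1 - a)]
    is point covering, because for b in a point K either K[1/b] = 0, so that b
    is nilpotent and 1 - b is a unit, or K -> K[1/b] has a retraction, so that
    b is a unit ([point_invertible_or_sub]).  A retraction of A -> A[1/a] makes
    a invertible, so one of a and 1 - a is a unit for every a, and therefore
    the non-units form the unique maximal ideal ([local_ring_of_sum]).

    If A is local with maximal ideal M, then by Zorn's lemma everything outside
    M is invertible ([maximal_ideal_compl_invertible]).  The residue field A/M
    is a point, because a localisation of a field with a nonzero target inverts
    only units.  So A -> A/M factors through some member A -> A[S^-1] of any
    point covering family.  Then S avoids M, all its elements are units of A,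
    and the universal property of A[S^-1] retracts it onto A.

    Both A[1/a] and A/M are obtained from one construction, (A/I)[1/a]. *)

(** * Units and ideals *)

Lemma invertible1 (A : comPzRingType) : invertible (1 : A).
Proof. by exists 1; rewrite mulr1. Qed.

Lemma invertible_rmorph (A B : comPzRingType) (u : {rmorphism A -> B}) a :
  invertible a -> invertible (u a).
Proof. by case=> b ab; exists (u b); rewrite -rmorphM ab rmorph1. Qed.

Lemma invertible_mull (A : comPzRingType) (a b : A) :
  invertible (a * b) -> invertible a.
Proof. by case=> c abc; exists (b * c); rewrite mulrA. Qed.

Lemma not_invertible0 (A : comPzRingType) :
  (1 : A) <> 0 -> ~ invertible (0 : A).
Proof. by move=> nz [b]; rewrite mul0r => /esym. Qed.

Lemma invertible_1subr_nilpotent (A : comPzRingType) (a : A) n :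
  a ^+ n = 0 -> invertible (1 - a).
Proof.
move=> an0; exists (\sum_(i < n) a ^+ i).
by rewrite -opprB mulNr -subrX1 an0 sub0r opprK.
Qed.

Section Ideals.
Variables (A : comPzRingType) (I : set A).
Hypothesis idI : ideal I.

Lemma ideal0 : I 0. Proof. by case: idI. Qed.

Lemma idealD x y : I x -> I y -> I (x + y).
Proof. by case: idI => _ + _; apply. Qed.

Lemma idealM a x : I x -> I (a * x).
Proof. by case: idI => _ _; apply. Qed.

Lemma ideal_invertible x : invertible x -> I x -> I 1.
Proof. by case=> y xy Ix; rewrite -xy mulrC; apply: idealM. Qed.

End Ideals.

Lemma ideal_zero (A : comPzRingType) : ideal [set (0 : A)].
Proof.
by split=> // [x y -> ->|a x ->]; rewrite ?addr0 ?mulr0.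
Qed.

(** * The ring (A/I)[1/a] *)

Section Fractions.
Variables (A : comPzRingType) (I : set A) (idI : ideal I) (a : A).

(** A pair (x, n) stands for the fraction x / a^n.  The factor a^k is needed
    for transitivity, as a may be a zero divisor modulo I. *)
Definition frac_rel (p q : A * nat) : bool :=
  `[< exists k, I (a ^+ k * (a ^+ q.2 * p.1 - a ^+ p.2 * q.1)) >].

Lemma frac_rel_refl : reflexive frac_rel.
Proof. by move=> p; apply/asboolP; exists 0; rewrite subrr mulr0; apply: ideal0. Qed.

Lemma frac_rel_sym : symmetric frac_rel.
Proof.
suff h p q : frac_rel p q -> frac_rel q p by move=> p q; apply/idP/idP; apply: h.
move=> /asboolP[k Ik]; apply/asboolP; exists k.
have := idealM idI (-1) Ik; congr I; ring.
Qed.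

Lemma frac_rel_trans : transitive frac_rel.
Proof.
move=> [y m] [x n] [z p] /asboolP[k /= Ik] /asboolP[l /= Il].
apply/asboolP; exists (k + l + m)%N => /=.
have := idealD idI (idealM idI (a ^+ (l + p)) Ik) (idealM idI (a ^+ (k + n)) Il).
by congr I; rewrite !exprD; ring.
Qed.

Definition frac_equiv := EquivRel frac_rel frac_rel_refl frac_rel_sym frac_rel_trans.

Definition frac := {eq_quot frac_equiv}.

HB.instance Definition _ := Choice.on frac.
HB.instance Definition _ := EqQuotient.on frac.

Lemma frac_piP (p q : A * nat) :
  \pi_frac p = \pi_frac q <->
  exists k, I (a ^+ k * (a ^+ q.2 * p.1 - a ^+ p.2 * q.1)).
Proof. by split=> [/eqmodP/asboolP|h] //; apply/eqmodP/asboolP. Qed.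

(** The ring axioms hold by cross-multiplication in A itself, without any
    appeal to I or to further powers of a. *)
Lemma frac_pi_eq (p q : A * nat) :
  a ^+ q.2 * p.1 = a ^+ p.2 * q.1 -> \pi_frac p = \pi_frac q.
Proof.
by move=> e; apply/frac_piP; exists 0; rewrite e subrr mulr0; apply: ideal0.
Qed.

Definition frac_zero : frac := \pi_frac (0, 0%N).
Definition frac_one : frac := \pi_frac (1, 0%N).
Definition frac_opp (b : frac) : frac := \pi_frac (- (repr b).1, (repr b).2).
Definition frac_add (b c : frac) : frac :=
  \pi_frac (a ^+ (repr c).2 * (repr b).1 + a ^+ (repr b).2 * (repr c).1,
            ((repr b).2 + (repr c).2)%N).
Definition frac_mul (b c : frac) : frac :=
  \pi_frac ((repr b).1 * (repr c).1, ((repr b).2 + (repr c).2)%N).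

Lemma frac_pi_repr (p : A * nat) :
  exists k, I (a ^+ k * (a ^+ p.2 * (repr (\pi_frac p)).1
                          - a ^+ (repr (\pi_frac p)).2 * p.1)).
Proof. by apply/frac_piP; rewrite reprK. Qed.

Lemma frac_oppE x n : frac_opp (\pi_frac (x, n)) = \pi_frac (- x, n).
Proof.
rewrite /frac_opp; have [k /=] := frac_pi_repr (x, n).
case: (repr _) => x' n' /= Ik; apply/frac_piP; exists k => /=.
have := idealM idI (-1) Ik; congr I; ring.
Qed.

Lemma frac_addE x n y m :
  frac_add (\pi_frac (x, n)) (\pi_frac (y, m)) =
  \pi_frac (a ^+ m * x + a ^+ n * y, (n + m)%N).
Proof.
rewrite /frac_add; have [k /=] := frac_pi_repr (x, n).
have [l /=] := frac_pi_repr (y, m).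
case: (repr _) => y' m'; case: (repr _) => x' n' /= Il Ik.
apply/frac_piP; exists (k + l)%N => /=.
have := idealD idI (idealM idI (a ^+ (l + m + m')) Ik)
  (idealM idI (a ^+ (k + n + n')) Il).
by congr I; rewrite !exprD; ring.
Qed.

Lemma frac_mulE x n y m :
  frac_mul (\pi_frac (x, n)) (\pi_frac (y, m)) = \pi_frac (x * y, (n + m)%N).
Proof.
rewrite /frac_mul; have [k /=] := frac_pi_repr (x, n).
have [l /=] := frac_pi_repr (y, m).
case: (repr _) => y' m'; case: (repr _) => x' n' /= Il Ik.
apply/frac_piP; exists (k + l)%N => /=.
have := idealD idI (idealM idI (a ^+ (l + m) * y') Ik)
  (idealM idI (a ^+ (k + n') * x) Il).
by congr I; rewrite !exprD; ring.
Qed.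

Lemma frac_ind (P : frac -> Prop) :
  (forall x n, P (\pi_frac (x, n))) -> forall b, P b.
Proof. by move=> h; apply: quotW => -[x n]. Qed.

Lemma frac_addA : associative frac_add.
Proof.
elim/frac_ind=> x n; elim/frac_ind=> y m; elim/frac_ind=> z p.
by rewrite !frac_addE; apply: frac_pi_eq => /=; rewrite !exprD; ring.
Qed.

Lemma frac_addC : commutative frac_add.
Proof.
elim/frac_ind=> x n; elim/frac_ind=> y m.
by rewrite !frac_addE; apply: frac_pi_eq => /=; rewrite !exprD; ring.
Qed.

Lemma frac_add0 : left_id frac_zero frac_add.
Proof.
elim/frac_ind=> x n.
by rewrite frac_addE; apply: frac_pi_eq => /=; rewrite !exprD; ring.
Qed.

Lemma frac_addN : left_inverse frac_zero frac_opp frac_add.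
Proof.
elim/frac_ind=> x n.
by rewrite frac_oppE frac_addE; apply: frac_pi_eq => /=; rewrite !exprD; ring.
Qed.

HB.instance Definition _ :=
  GRing.isZmodule.Build frac frac_addA frac_addC frac_add0 frac_addN.

Lemma frac_mulA : associative frac_mul.
Proof.
elim/frac_ind=> x n; elim/frac_ind=> y m; elim/frac_ind=> z p.
by rewrite !frac_mulE; apply: frac_pi_eq => /=; rewrite !exprD; ring.
Qed.

Lemma frac_mulC : commutative frac_mul.
Proof.
elim/frac_ind=> x n; elim/frac_ind=> y m.
by rewrite !frac_mulE; apply: frac_pi_eq => /=; rewrite !exprD; ring.
Qed.

Lemma frac_mul1 : left_id frac_one frac_mul.
Proof.
elim/frac_ind=> x n.
by rewrite frac_mulE; apply: frac_pi_eq => /=; rewrite mul1r.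
Qed.

Lemma frac_mulDl : left_distributive frac_mul frac_add.
Proof.
elim/frac_ind=> x n; elim/frac_ind=> y m; elim/frac_ind=> z p.
rewrite frac_addE !frac_mulE frac_addE.
by apply: frac_pi_eq => /=; rewrite !exprD; ring.
Qed.

HB.instance Definition _ := GRing.Zmodule_isComPzRing.Build frac
  frac_mulA frac_mulC frac_mul1 frac_mulDl.

Definition to_frac (x : A) : frac := \pi_frac (x, 0%N).

Lemma to_frac_is_zmod_morphism : zmod_morphism to_frac.
Proof.
move=> x y; rewrite [RHS](_ : _ = frac_add (to_frac x) (frac_opp (to_frac y))) //.
by rewrite frac_oppE frac_addE; congr (\pi_frac (_, _)); rewrite !expr0 !mul1r.
Qed.

Lemma to_frac_is_monoid_morphism : monoid_morphism to_frac.
Proof.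
by split=> // x y; rewrite [RHS](_ : _ = frac_mul (to_frac x) (to_frac y)) // frac_mulE.
Qed.

HB.instance Definition _ :=
  GRing.isZmodMorphism.Build A frac to_frac to_frac_is_zmod_morphism.
HB.instance Definition _ :=
  GRing.isMonoidMorphism.Build A frac to_frac to_frac_is_monoid_morphism.

Definition frac_inv : frac := \pi_frac (1, 1%N).

Lemma to_frac_inv : to_frac a * frac_inv = 1.
Proof.
rewrite [LHS](_ : _ = frac_mul (to_frac a) frac_inv) // frac_mulE.
by apply: frac_pi_eq => /=; rewrite expr0 mul1r.
Qed.

Lemma frac_inv_exp n : frac_inv ^+ n = \pi_frac (1, n).
Proof.
elim: n => [//|n IH]; rewrite exprS IH.
by rewrite [LHS](_ : _ = frac_mul frac_inv (\pi_frac (1, n))) // frac_mulE mul1r.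
Qed.

(** With [to_frac_inv] and the kernel computed in [to_frac_eq0], this
    determines the ring up to isomorphism, so later arguments about it use no
    pairs. *)
Lemma fracP (b : frac) : exists x n, b = to_frac x * frac_inv ^+ n.
Proof.
elim/frac_ind: b => x n; exists x, n; rewrite frac_inv_exp.
by rewrite [RHS](_ : _ = frac_mul (to_frac x) (\pi_frac (1, n))) // frac_mulE mulr1.
Qed.

Lemma to_frac_eq0 x : to_frac x = 0 <-> exists k, I (a ^+ k * x).
Proof.
rewrite [X in X <-> _]frac_piP /=.
by split=> -[k h]; exists k; move: h; rewrite expr0 mul1r mulr0 subr0.
Qed.

End Fractions.

(** * The localisation A[1/a] *)

Definition localise (A : comPzRingType) (a : A) : comPzRingType :=
  frac (ideal_zero A) a.

Definition to_localise (A : comPzRingType) (a : A) :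
  {rmorphism A -> localise a} := @to_frac A _ (ideal_zero A) a.

Lemma expr_mul_inv (B : comPzRingType) (s c : B) k :
  s * c = 1 -> s ^+ k * c ^+ k = 1.
Proof. by move=> sc; rewrite -exprMn sc expr1n. Qed.

Lemma mul_inv_expB (B : comPzRingType) (s c x y : B) n m :
  s * c = 1 ->
  x * c ^+ n - y * c ^+ m = (s ^+ m * x - s ^+ n * y) * c ^+ (n + m).
Proof.
move=> sc; rewrite exprD mulrBl; congr (_ - _).
  by rewrite -[LHS]mulr1 -(expr_mul_inv m sc); ring.
by rewrite -[LHS]mulr1 -(expr_mul_inv n sc); ring.
Qed.

Lemma mul_expr_eq0 (B : comPzRingType) (s c x : B) k :
  s * c = 1 -> s ^+ k * x = 0 -> x = 0.
Proof.
move=> sc skx; rewrite -[x]mul1r -(expr_mul_inv k sc).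
by rewrite mulrAC skx mul0r.
Qed.

(** An element of A[1/a] is sent to f x * d^n for a chosen expression x / a^n.
    The value does not depend on the choice: if x / a^n = 0 then a^k x = 0 for
    some k, and f a is a unit. *)
Lemma localise_universal (A : comPzRingType) (a : A) (C : comPzRingType)
    (f : {rmorphism A -> C}) (d : C) :
  f a * d = 1 ->
  exists g : {rmorphism localise a -> C},
    (forall x, g (to_localise a x) = f x) /\ g (frac_inv (ideal_zero A) a) = d.
Proof.
move=> ad; set c := frac_inv _ _; set u := to_localise a.
have uc : u a * c = 1 by apply: to_frac_inv.
have P (b : localise a) : {p : A * nat | b = u p.1 * c ^+ p.2}.
  by apply: cid; have [x [n ->]] := fracP b; exists (x, n).
pose g b : C := f (sval (P b)).1 * d ^+ (sval (P b)).2.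
have gE x n : g (u x * c ^+ n) = f x * d ^+ n.
  rewrite /g; case: (P _) => -[y m] /= /eqP.
  rewrite -subr_eq0 (mul_inv_expB _ _ _ _ uc) mulrC => /eqP.
  have cu : c * u a = 1 by rewrite mulrC.
  move=> /(mul_expr_eq0 cu); rewrite -!rmorphXn -!rmorphM -rmorphB.
  move=> /to_frac_eq0[k /= /(congr1 f)].
  rewrite rmorphM rmorph0 rmorphXn => /(mul_expr_eq0 ad) fxy.
  apply/esym/eqP; rewrite -subr_eq0 (mul_inv_expB _ _ _ _ ad).
  by rewrite -!rmorphXn -!rmorphM -rmorphB fxy mul0r.
have gz : zmod_morphism g.
  move=> b b'; have [x [n ->]] := fracP b; have [y [m ->]] := fracP b'.
  rewrite -/u -/c (mul_inv_expB _ _ _ _ uc) -!rmorphXn -!rmorphM -rmorphB !gE.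
  by rewrite (mul_inv_expB _ _ _ _ ad) -!rmorphXn -!rmorphM -rmorphB.
have gm : monoid_morphism g.
  split=> [|b b'].
    by rewrite -[1](rmorph1 u) -[u 1]mulr1 -(expr0 c) gE rmorph1 mulr1.
  have [x [n ->]] := fracP b; have [y [m ->]] := fracP b'.
  rewrite mulrACA -rmorphM -exprD !gE rmorphM exprD; ring.
pose G : {rmorphism localise a -> C} :=
  HB.pack g (GRing.isZmodMorphism.Build _ _ g gz)
            (GRing.isMonoidMorphism.Build _ _ g gm).
exists G; split=> [x|] /=.
  by rewrite -[to_localise a x]mulr1 -(expr0 c) gE mulr1.
by rewrite -[c]mul1r -[1](rmorph1 u) -{1}[c]expr1 gE rmorph1 mul1r.
Qed.

Lemma localise_hom_unique (A : comPzRingType) (a : A) (C : comPzRingType)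
    (f : {rmorphism A -> C}) (g g' : {rmorphism localise a -> C}) :
  (forall x, g (to_localise a x) = f x) ->
  (forall x, g' (to_localise a x) = f x) -> g' =1 g.
Proof.
move=> gf g'f b; have [x [n ->]] := fracP b.
rewrite !rmorphM !rmorphXn /= gf g'f; congr (_ * _ ^+ _).
set c := frac_inv _ _.
have e (h : {rmorphism localise a -> C}) :
    (forall x, h (to_localise a x) = f x) -> f a * h c = 1.
  by move=> hf; rewrite -hf -rmorphM to_frac_inv rmorph1.
by rewrite -[LHS]mulr1 -(e g) // mulrA (mulrC _ (f a)) e // mul1r.
Qed.

Lemma localise_localisation (A : comPzRingType) (a : A) :
  localisation (to_localise a).
Proof.
exists [set a]; split=> [_ ->|C f /(_ a erefl)[d ad]].
  by exists (frac_inv (ideal_zero A) a); apply: to_frac_inv.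
have [g [gf _]] := localise_universal ad.
by exists g; split=> // g'; apply: localise_hom_unique.
Qed.

(** A[1/a] is A[X] / (aX - 1). *)
Lemma localise_finite_presentation (A : comPzRingType) (a : A) :
  finite_presentation (to_localise a).
Proof.
pose p : polynomial_terms A 1 := [:: (a, [ffun=> 1%N]); (-1, [ffun=> 0%N])].
have pE (C : comPzRingType) (v : {rmorphism A -> C}) y :
    eval_terms v y p = v a * y ord0 - 1.
  rewrite /eval_terms !big_cons big_nil !big_ord1 !ffunE /=.
  by rewrite rmorphN rmorph1; ring.
exists 1%N, 1%N, (fun=> p), (fun=> frac_inv (ideal_zero A) a).
split=> [_|C v y /(_ ord0)]; rewrite pE.
  by rewrite to_frac_inv subrr.
move=> /eqP; rewrite subr_eq0 => /eqP /localise_universal[g [gv gy]].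
exists g; split=> [|g' g'v _]; last exact: localise_hom_unique gv g'v.
by split=> // i; rewrite gy (ord1 i).
Qed.

Lemma localise_eq0 (A : comPzRingType) (a : A) :
  (1 : localise a) = 0 -> exists k, a ^+ k = 0.
Proof.
rewrite -(rmorph1 (to_localise a)) => /to_frac_eq0[k /=].
by rewrite mulr1; exists k.
Qed.

(** * Points *)

(** If u is conservative, then the identity of A inverts every element of S, so
    it factors through A -> A[S^-1]. *)
Lemma localisation_retraction (A B : comPzRingType) (u : {rmorphism A -> B}) :
  localisation u -> (forall a, invertible (u a) -> invertible a) ->
  has_retraction u.
Proof.
case=> S [uS univ] cons; pose idA : {rmorphism A -> A} := idfun.
have [s /uS/cons //|g [gu _]] := univ A idA.
by exists g.
Qed.

Lemma localise_retraction (A : comPzRingType) (a : A) :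
  has_retraction (to_localise a) -> invertible a.
Proof.
case=> r ru; rewrite -(ru a); apply: invertible_rmorph.
by exists (frac_inv (ideal_zero A) a); apply: to_frac_inv.
Qed.

Lemma point_invertible_or_sub (K : comPzRingType) (b : K) :
  Defs.point (@localisation) K -> invertible b \/ invertible (1 - b).
Proof.
case=> _ retr; have [B0|Bn0] := pselect ((1 : localise b) = 0).
  by have [k /invertible_1subr_nilpotent] := localise_eq0 B0; right.
left; apply: localise_retraction; apply: retr => //.
  exact: localise_localisation.
exact: localise_finite_presentation.
Qed.

Lemma field_point (K : comPzRingType) :
  (1 : K) <> 0 -> (forall b : K, b <> 0 -> invertible b) ->
  Defs.point (@localisation) K.
Proof.
move=> nz field; split=> // B u locu _ Bn0.
apply: localisation_retraction => // b ub; apply: field => b0.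
by move: ub; rewrite b0 rmorph0; apply: not_invertible0.
Qed.

(** * Maximal ideals *)

Lemma proper_ideal_sub_maximal (A : comPzRingType) (J : set A) :
  ideal J -> ~ J 1 -> exists M, maximal_ideal M /\ J `<=` M.
Proof.
move=> idJ J1.
(* Zorn's lemma is applied to the X such that the union of J and X, rather than
   X, is a proper ideal: this holds for the union of the empty chain too. *)
have [|M [[idM M1] maxM]] :=
    @Zorn_bigcup A [set X | ideal (J `|` X) /\ ~ (J `|` X) 1].
  move=> F FP totF.
  have F2 x y : (J `|` \bigcup_(X in F) X) x -> (J `|` \bigcup_(X in F) X) y ->
      (J x /\ J y) \/ exists2 X, F X & (J `|` X) x /\ (J `|` X) y.
    move=> [Jx|[X FX Xx]] [Jy|[Y FY Yy]]; [by left| | |]; right.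
    - by exists Y => //; split; [left|right].
    - by exists X => //; split; [right|left].
    - have [XY|YX] := totF X Y FX FY.
        by exists Y => //; split; right => //; apply: XY.
      by exists X => //; split; right => //; apply: YX.
  split; last by case=> // -[X FX X1]; have [_] := FP X FX; apply; right.
  split=> [|x y Ux Uy|b x Ux]; first by left; apply: ideal0.
    have [[Jx Jy]|[X FX [Xx Xy]]] := F2 x y Ux Uy.
      by left; apply: idealD.
    have [idX _] := FP X FX.
    by have [|] := idealD idX Xx Xy; [left|right; exists X].
  case: Ux => [Jx|[X FX Xx]]; first by left; apply: idealM.
  have [idX _] := FP X FX.
  by have [||] := @idealM _ _ idX b x; [right|left|right; exists X].
exists (J `|` M); split; last by move=> x; left.
split=> // N idN N1 sMN; apply/seteqP; split=> // x Nx; apply: contrapT => Mx.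
apply: (maxM N).
  by split=> [y My|/(_ x Nx) xM]; [apply: sMN; right|apply: Mx; right].
have JN : J `|` N = N by apply: setUidr => y Jy; apply: sMN; left.
by split; rewrite JN.
Qed.

(** The non-units are closed under addition: if (x + y) z = 1, then x z and
    y z = 1 - x z cannot both be non-units. *)
Lemma local_ring_of_sum (A : comPzRingType) :
  (1 : A) <> 0 -> (forall a : A, invertible a \/ invertible (1 - a)) ->
  local_ring A.
Proof.
move=> nz dich; pose M : set A := [set a | ~ invertible a].
have idM : ideal M.
  split=> [|x y Mx My [z xyz]|b x Mx]; first exact: not_invertible0.
    have [/invertible_mull //|] := dich (x * z).
    by rewrite -xyz mulrDl addrC addKr => /invertible_mull.
  by rewrite mulrC => /invertible_mull.
have M1 : ~ M 1 by apply; apply: invertible1.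
have properM J : ideal J -> ~ J 1 -> J `<=` M.
  by move=> idJ J1 x Jx xinv; apply/J1/(ideal_invertible idJ xinv).
exists M; split=> [|N [idN N1 maxN]]; last by apply: maxN => //; apply: properM.
split=> // J idJ J1 MJ; apply/seteqP; split=> //; exact: properM.
Qed.

(** A non-unit a generates a proper ideal, hence lies in some maximal ideal,
    and M is the only one. *)
Lemma maximal_ideal_compl_invertible (A : comPzRingType) (M : set A) (a : A) :
  (forall N, maximal_ideal N -> M = N) -> ~ M a -> invertible a.
Proof.
move=> uniqM Ma; apply: contrapT => ainv; apply: Ma.
have idJ : ideal [set x | exists b, x = b * a].
  split=> [|_ _ [b ->] [c ->]|c _ [b ->]]; first by exists 0; rewrite mul0r.
    by exists (b + c); rewrite mulrDl.
  by exists (c * b); rewrite mulrA.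
have [[b ab]|N [maxN]] := proper_ideal_sub_maximal idJ.
  by apply: ainv; exists b; rewrite mulrC -ab.
by rewrite (uniqM N maxN); apply; exists 1; rewrite mul1r.
Qed.

(** * Local objects *)

Lemma local_object_local_ring (A : comPzRingType) :
  local_object (@localisation) A -> local_ring A.
Proof.
move=> locA; apply: local_ring_of_sum => [A0|a].
  have [|[]] := locA False (fun=> A) (fun=> idfun).
  split=> [[]|K f [K1 _]]; case: K1.
  by rewrite -(rmorph1 f) A0 rmorph0.
pose s (i : bool) := if i then a else 1 - a.
have [|i /localise_retraction] := locA bool _ (fun i => to_localise (s i)).
  split=> [i|K f ptK].
    split; [exact: localise_localisation|exact: localise_finite_presentation].
  have [i [d fd]] : exists i, invertible (f (s i)).
    have [h|h] := point_invertible_or_sub (f a) ptK; first by exists true.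
    by exists false; rewrite rmorphB rmorph1.
  by have [g [gf _]] := localise_universal fd; exists i, g.
by case: i; [left|right].
Qed.

Lemma local_ring_local_object (A : comPzRingType) :
  local_ring A -> local_object (@localisation) A.
Proof.
case=> M [[idM M1 _] uniqM] I B u [covL covK].
have inv a : ~ M a -> invertible a by apply: maximal_ideal_compl_invertible.
(* K is A/M: inverting 1 changes nothing. *)
pose K : comPzRingType := frac idM 1.
pose f : {rmorphism A -> K} := @to_frac A M idM 1.
have f0 x : f x = 0 <-> M x.
  rewrite to_frac_eq0; split=> [[k]|Mx]; first by rewrite expr1n mul1r.
  by exists 0%N; rewrite mul1r.
have Kn0 : (1 : K) <> 0 by rewrite -(rmorph1 f) => /f0.
have ptK : Defs.point (@localisation) K.
  apply: field_point => // b; have [x [n ->]] := fracP b.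
  have -> : frac_inv idM 1 = 1 by rewrite -[LHS]mul1r -(rmorph1 f) to_frac_inv.
  rewrite expr1n mulr1 => fx; apply: (invertible_rmorph f); apply: inv.
  by move=> /f0.
have [i [g gf]] := covK K f ptK.
exists i; apply: localisation_retraction; first by have [] := covL i.
move=> a /(invertible_rmorph g); rewrite gf => finv; apply: inv => /f0 fa.
by move: finv; rewrite fa; apply: not_invertible0.
Qed.

Theorem proposition59 (A : comPzRingType) :
  local_object (@localisation) A <-> local_ring A.
Proof.
by split; [exact: local_object_local_ring|exact: local_ring_local_object].
Qed.
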